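(* Let $\mathfrak X\subset\mathbb R^n$ be an open region and let $A=\sum_{|\alpha|>0}\mathfrak a_\alpha(x)\partial_{x^\alpha}$ be a generator (in the form of an infinite order differential operator) with affine coefficients, i.e. for all multi-indices $\alpha$ $$\mathfrak a_\alpha(x)=c_\alpha+x^\top d_\alpha,\qquad x\in\mathfrak X,$$ where $c_\alpha$ is a scalar constant and $d_\alpha\in\mathbb R^n$ is a constant vector. Assume that the series $\sum_{|\alpha|>0}\mathfrak a_\alpha(x)(\mathfrak i u)^\alpha$ converges absolutely for all $u\in\mathbb R^n$ (and $x\in\mathfrak X$). Let $f_u(x)=e^{\mathfrak i u^\top x}$. Then for every $u\in\mathbb R^n$, $x\in\mathfrak X$ and every integer $r\ge0$, $$|A^rf_u(x)|\le (r+1)!\,2^{nr}(1+\|x\|)^r\,\theta(\|u\|)^r,$$ where $\|x\|=\max_{i=1,\dots,n}|x_i|$, $$\theta(v):=\sum_{k\ge1}2^k(1+v)^k\mathcal D_k^{\mathfrak a},\quad v\in\mathbb R_+,\qquad \mathcal D_k^{\mathfrak a}:=\sup_{x\in\mathfrak X}\ \max_{|\alpha|=k,\ |\beta|\le1}\frac{|\partial_{x^\beta}\mathfrak a_\alpha(x)|}{1+\|x\|}.$$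
   Context: Multi-index notation is used: $\alpha\in\mathbb N_0^n$, $|\alpha|=\sum\alpha_i$, $\partial_{x^\alpha}=\partial^{|\alpha|}/\partial x_1^{\alpha_1}\cdots\partial x_n^{\alpha_n}$, $u^\alpha=\prod u_i^{\alpha_i}$; $\mathfrak i$ is the imaginary unit. The operator acts by $Af(x)=\sum_{|\alpha|>0}\mathfrak a_\alpha(x)\partial_{x^\alpha}f(x)$ on functions for which the series converges. This form arises by formally Taylor-expanding the integral term in the integro-differential operator $\frac12\sum a_{ij}\partial_{ij}f+\sum b_i\partial_if+\int[f(x+z)-f(x)-\frac{\partial f}{\partial x}\cdot z]v(x,dz)$, so that $\mathfrak a_{e_i}=b_i$, $\mathfrak a_\alpha=\frac1{\alpha!}\big(a_{ij}+\int z^\alpha v(x,dz)\big)$ for $\alpha=e_i+e_j$, and $\mathfrak a_\alpha=\frac1{\alpha!}\int z^\alpha v(x,dz)$ for $|\alpha|\ge3$. $A$ need not be the generator of a stochastic process. *)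

(* Defs.v *)
From mathcomp Require Import all_boot all_order all_algebra.
From mathcomp Require Import complex.
From mathcomp Require Import all_classical all_reals all_analysis.
Set Implicit Arguments.
Unset Strict Implicit.
Unset Printing Implicit Defensive.
Import Order.TTheory GRing.Theory Num.Theory.
Import numFieldNormedType.Exports.
Local Open Scope classical_set_scope.
Local Open Scope ring_scope.
Local Open Scope complex_scope.

(* R^n is 'rV[R]_n, and `|x| on it is the library's norm of matrices, that is
   the maximum norm. R[i] carries no topology over R in the library, so
   derivatives and sums of complex-valued functions are taken on the real and
   imaginary parts; ComplexField.Normc.normc is the modulus, with values in R. *)

Definition multi_index (n : nat) := {ffun 'I_n -> nat}.

Definition mdegree (n : nat) (alpha : multi_index n) : nat :=
  (\sum_i alpha i)%N.

Definition dotv (R : realType) (n : nat) (u x : 'rV[R]_n) : R :=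
  \sum_i u 0 i * x 0 i.

Section partial_derivatives.
Context (R : realType) (n : nat).
Implicit Types (f : 'rV[R]_n -> R) (F : 'rV[R]_n -> R[i]).

Definition partial (i : 'I_n) f : 'rV[R]_n -> R := 'D_(delta_mx 0 i) f.

(* the head of s is the outermost derivative *)
Definition iter_partial (s : seq 'I_n) f : 'rV[R]_n -> R := foldr partial f s.

Definition mpartial (alpha : multi_index n) f : 'rV[R]_n -> R :=
  iter_partial (flatten [seq nseq (alpha i) i | i <- enum 'I_n]) f.

Definition cmpartial (alpha : multi_index n) F : 'rV[R]_n -> R[i] := fun x =>
  mpartial alpha (fun y => complex.Re (F y)) x +i*
  mpartial alpha (fun y => complex.Im (F y)) x.

(* class C^oo on X, which is meant to be open *)
Definition smooth_on (X : set 'rV[R]_n) f :=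
  forall (s : seq 'I_n) (x : 'rV[R]_n), X x ->
    {for x, continuous (iter_partial s f)} /\
    forall i, derivable (iter_partial s f) x (delta_mx 0 i).

End partial_derivatives.

Section unordered_sums.
Context (R : realType) (I : choiceType).

Definition abs_summable (D : set I) (z : I -> R[i]) :=
  (\esum_(k in D) (ComplexField.Normc.normc (z k))%:E < +oo)%E.

(* The sum of an absolutely convergent family of reals, as the difference of
   the sums of its positive and negative parts. *)
Definition rsum (D : set I) (g : I -> R) : R :=
  fine (\esum_(k in D) ((EFin \o g)^\+ k) - \esum_(k in D) ((EFin \o g)^\- k))%E.

Definition csum (D : set I) (z : I -> R[i]) : R[i] :=
  rsum D (fun k => complex.Re (z k)) +i* rsum D (fun k => complex.Im (z k)).

End unordered_sums.

Section infinite_order_operator.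
Context (R : realType) (n : nat).
Implicit Types (X : set 'rV[R]_n) (a : multi_index n -> 'rV[R]_n -> R).
Implicit Types (F : 'rV[R]_n -> R[i]) (u x : 'rV[R]_n).

Definition nonzero_index : set (multi_index n) :=
  [set alpha | (0 < mdegree alpha)%N].

Definition symbol_term a u x (alpha : multi_index n) : R[i] :=
  (a alpha x)%:C * \prod_i (0 +i* u 0 i) ^+ alpha i.

Definition operator_term a F x (alpha : multi_index n) : R[i] :=
  (a alpha x)%:C * cmpartial alpha F x.

Definition operator_domain X a F :=
  [/\ smooth_on X (fun x => complex.Re (F x)),
      smooth_on X (fun x => complex.Im (F x))
    & forall x, X x -> abs_summable nonzero_index (operator_term a F x)].

(* Functions are total on R^n, but only their values on X matter: when X is
   open, the values on X of operator a F are determined by those of a and F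
   on X. *)
Definition operator a F : 'rV[R]_n -> R[i] := fun x =>
  csum nonzero_index (operator_term a F x).

(* x |-> exp (i u.x) *)
Definition character u : 'rV[R]_n -> R[i] := fun x =>
  cos (dotv u x) +i* sin (dotv u x).

(* The inner supremum is over a finite set of pairs (alpha, beta). *)
Definition coef_bound X a (k : nat) : \bar R :=
  ereal_sup [set
    ereal_sup [set (`|mpartial p.2 (a p.1) x| / (1 + `|x|))%:E |
      p in [set p : multi_index n * multi_index n |
              mdegree p.1 = k /\ (mdegree p.2 <= 1)%N]]
    | x in X].

Definition theta X a (v : R) : \bar R :=
  (\sum_(1 <= k <oo) (2 ^+ k * (1 + v) ^+ k)%:E * coef_bound X a k)%E.

End infinite_order_operator.

(* Main.v *)
(* On X, A^r f_u = exp(i u.x) P_r for a polynomial P_r of degree at most r in x.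
   If T_i P = d_i P + i u_i P, then d_i (exp(i u.x) P) = exp(i u.x) T_i P, so
   P_(r+1) = sum_alpha (c_alpha + x.d_alpha) T^alpha P_r, the sum being taken
   coefficientwise: the degree stays bounded, hence every linear functional of
   polynomials, in particular P |-> (d_t P)(x), commutes with the sum. The
   induction bounds all partial derivatives of P_r at x simultaneously. If they
   are all at most K, then those of T^alpha P_r are at most (1 + |u|)^|alpha| K,
   and multiplying by an affine coefficient costs a factor (1 + |t|)
   (1 + |x|) D_|alpha| for a derivative d_t of order |t|, where |t| <= r + 1
   because higher derivatives of P_(r+1) vanish. Summing over alpha, of which at
   most 2^(n+k) have degree k, gives the factor (r + 2) 2^n (1 + |x|) theta. *)

Require Import Defs.
From mathcomp Require Import all_boot all_order all_algebra.
From mathcomp Require Import complex.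
From mathcomp Require Import finmap ring.
From mathcomp Require mpoly.
Import -(notations) mpoly.
From mathcomp Require Import all_classical all_reals all_analysis.
Import Order.TTheory GRing.Theory Num.Theory.
Import numFieldNormedType.Exports.
Local Open Scope classical_set_scope.
Local Open Scope ring_scope.
Set Implicit Arguments.
Unset Strict Implicit.
Unset Printing Implicit Defensive.

(** * The modulus on the complex numbers *)

Section modulus.
Context (R : realType).
Implicit Types (z w : R[i]).
Local Notation normc := ComplexField.Normc.normc.

Lemma normc_ge0 z : 0 <= normc z.
Proof. by case: z => x y /=; exact: sqrtr_ge0. Qed.

Lemma normcX z k : normc (z ^+ k) = normc z ^+ k.
Proof.
elim: k => [|k IH]; first by rewrite !expr0 ComplexField.Normc.normc1.
by rewrite !exprS ComplexField.Normc.normcM IH.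
Qed.

Lemma normc_prod (T : Type) (s : seq T) (F : T -> R[i]) :
  normc (\prod_(k <- s) F k) = \prod_(k <- s) normc (F k).
Proof.
elim/big_rec2: _ => [|k x y _ <-]; first exact: ComplexField.Normc.normc1.
exact: ComplexField.Normc.normcM.
Qed.

Lemma normc_real (x : R) : normc (real_complex R x) = `|x|.
Proof. by rewrite /= expr0n addr0 sqrtr_sqr. Qed.

Lemma normc_imag (x : R) : normc (Complex 0 x) = `|x|.
Proof. by rewrite /= expr0n add0r sqrtr_sqr. Qed.

Lemma normRe_le z : `|complex.Re z| <= normc z.
Proof.
case: z => x y /=; rewrite -(sqrtr_sqr x) ler_sqrt ?lerDl ?sqr_ge0//.
by rewrite addr_ge0 ?sqr_ge0.
Qed.

Lemma normIm_le z : `|complex.Im z| <= normc z.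
Proof.
case: z => x y /=; rewrite -(sqrtr_sqr y) ler_sqrt ?lerDr ?sqr_ge0//.
by rewrite addr_ge0 ?sqr_ge0.
Qed.

(** The witness is the conjugate of [z] divided by its modulus. This trades a modulus for a real
    part, so that complex sums can be estimated by real ones. *)
Lemma normc_rotation z :
  exists2 w, normc w = 1 & normc z = complex.Re (w * z).
Proof.
(* At [z = 0] the quotient has no modulus 1; any unit serves there. *)
have [z0|z0] := eqVneq (normc z) 0.
  exists 1; first exact: ComplexField.Normc.normc1.
  by rewrite mul1r z0 (ComplexField.Normc.eq0_normc z0).
have e : normc z ^+ 2 = complex.Re z ^+ 2 + complex.Im z ^+ 2.
  by case: z {z0} => x y; rewrite /= sqr_sqrtr ?addr_ge0 ?sqr_ge0.
exists (Complex (complex.Re z / normc z) (- (complex.Im z / normc z))).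
  rewrite /= sqrrN !exprMn -mulrDl -e exprVn mulfV ?sqrtr1//.
  by rewrite expf_neq0.
case: z z0 e => x y z0 /= e; rewrite mulNr opprK [x / _ * x]mulrAC [y / _ * y]mulrAC.
by rewrite -mulrDl -!expr2 -[X in _ = X / _]e expr2 mulfK.
Qed.

End modulus.

(** * Linearity and triangle inequality for unordered sums *)

Section sums.
Context (R : realType) (I : choiceType) (D : set I).
Implicit Types (g h p q : I -> R) (z w : I -> R[i]).
Local Notation normc := ComplexField.Normc.normc.

Lemma esumZl g (c : R) : 0 <= c ->
  (\esum_(k in D) (c * g k)%:E = c%:E * \esum_(k in D) (g k)%:E)%E.
Proof.
move=> c0; rewrite /esum -ereal_supZl//; last first.
  by apply/set0P; eexists; exists set0; [exact: fsets_set0|reflexivity].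
congr ereal_sup; rewrite image_comp; apply: eq_imagel => A [fA _] /=.
rewrite !fsbig_finite//= sumEFin [X in (_ * X)%E]sumEFin -EFinM.
by rewrite mulr_sumr.
Qed.

Lemma summable_le g h : (forall k, D k -> `|g k| <= `|h k|) ->
  summable D (EFin \o h) -> summable D (EFin \o g).
Proof.
move=> gh; apply: le_lt_trans; apply: le_esum => k Dk /=.
by rewrite lee_fin; exact: gh.
Qed.

Lemma summableZ g c :
  summable D (EFin \o g) -> summable D (EFin \o (fun k => c * g k)).
Proof.
rewrite /summable /= => sg.
under eq_esum do rewrite normrM.
by rewrite esumZl// lte_mul_pinfty.
Qed.

Lemma summable_add g h : summable D (EFin \o g) -> summable D (EFin \o h) ->
  summable D (EFin \o (fun k => g k + h k)).
Proof. exact: summableD. Qed.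

Lemma summable_fsum (T : Type) (s : seq T) (g : T -> I -> R) :
  (forall t, summable D (EFin \o g t)) ->
  summable D (EFin \o (fun k => \sum_(t <- s) g t k)).
Proof.
move=> sg; elim: s => [|t s IH].
  by rewrite /summable esum1// => k _ /=; rewrite big_nil normr0.
have := summable_add (sg t) IH.
by apply: summable_le => k _; rewrite big_cons.
Qed.

Lemma summable_abs g : summable D (EFin \o g) ->
  summable D (EFin \o (fun k => `|g k|)).
Proof. by apply: summable_le => k _; rewrite normr_id. Qed.

Lemma esum_fin g : (forall k, D k -> 0 <= g k) -> summable D (EFin \o g) ->
  (\esum_(k in D) (g k)%:E \is a fin_num)%E.
Proof.
move=> g0; rewrite summableE (@eq_esum _ _ _ _ (fun k => (g k)%:E))//.
by move=> k Dk; rewrite /= ger0_norm// g0.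
Qed.

(** Frees [rsum] from the positive and negative parts: every splitting into nonnegative summable
    families computes the same value. *)
Lemma rsum_sub p q :
  (forall k, D k -> 0 <= p k) -> (forall k, D k -> 0 <= q k) ->
  summable D (EFin \o p) -> summable D (EFin \o q) ->
  rsum D (fun k => p k - q k) =
  fine (\esum_(k in D) (p k)%:E)%E - fine (\esum_(k in D) (q k)%:E)%E.
Proof.
move=> p0 q0 sp sq; have := @esumB _ _ D _ _ sp sq p0 q0; rewrite /rsum.
by move=> /= e; rewrite -fineB ?esum_fin// -e.
Qed.

(* Writing g = (|g| + g) - |g| keeps linearity free of the positive parts in [rsum]. *)
Lemma rsumE g : summable D (EFin \o g) ->
  rsum D g = fine (\esum_(k in D) (`|g k| + g k)%:E)%E -
             fine (\esum_(k in D) `|g k|%:E)%E.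
Proof.
move=> sg; rewrite -rsum_sub//.
- by congr rsum; apply: funext => k; rewrite addrC addKr.
- by move=> k _; rewrite -lerBlDr sub0r -normrN ler_norm.
- by apply: summable_add => //; exact: summable_abs.
- exact: summable_abs.
Qed.

Lemma esum_add p q :
  (forall k, D k -> 0 <= p k) -> (forall k, D k -> 0 <= q k) ->
  (\esum_(k in D) (p k + q k)%:E =
   \esum_(k in D) (p k)%:E + \esum_(k in D) (q k)%:E)%E.
Proof. by move=> p0 q0; rewrite -esumD. Qed.

Let addabs_ge0 g k : 0 <= `|g k| + g k.
Proof. by rewrite -lerBlDr sub0r -normrN ler_norm. Qed.

Let summable_addabs g : summable D (EFin \o g) ->
  summable D (EFin \o (fun k => `|g k| + g k)).
Proof. by move=> sg; apply: summable_add => //; exact: summable_abs. Qed.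

Lemma rsumD g h : summable D (EFin \o g) -> summable D (EFin \o h) ->
  rsum D (fun k => g k + h k) = rsum D g + rsum D h.
Proof.
move=> sg sh.
(* The splittings of [g] and [h] as in [rsumE], added up; both [p] and [q] are nonnegative. *)
pose p k := (`|g k| + g k) + (`|h k| + h k); pose q k := `|g k| + `|h k|.
have -> : (fun k => g k + h k) = (fun k => p k - q k).
  by apply: funext => k; rewrite /p /q addrACA [X in X - _]addrC addrK.
have sgh : summable D (EFin \o q) by apply: summable_add; exact: summable_abs.
rewrite rsum_sub//; last 3 first.
- by move=> k _; rewrite addr_ge0.
- by move=> k _; rewrite addr_ge0.
- by apply: summable_add; exact: summable_addabs.
rewrite (@esum_add (fun k => `|g k| + g k) (fun k => `|h k| + h k))//.
rewrite (@esum_add (fun k => `|g k|) (fun k => `|h k|))//.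
rewrite (rsumE sg) (rsumE sh).
have := summable_abs sg; have := summable_abs sh.
have := summable_addabs sg; have := summable_addabs sh => sg1 sg2 sg3 sg4.
rewrite !fineD ?esum_fin//.
by rewrite opprD addrACA.
Qed.

Lemma rsumZ g c : summable D (EFin \o g) ->
  rsum D (fun k => c * g k) = c * rsum D g.
Proof.
move=> sg; have sg1 := summable_abs sg; have sg2 := summable_addabs sg.
have [c0|/ltW c0] := leP 0 c.
  have -> : (fun k => c * g k) = (fun k => c * (`|g k| + g k) - c * `|g k|).
    by apply: funext => k; rewrite -mulrBr [X in X - _]addrC addrK.
  rewrite rsum_sub; do ?exact: summableZ; do ?by move=> k _; rewrite mulr_ge0.
  rewrite !esumZl// rsumE// !fineM ?esum_fin//.
  by rewrite -mulrBr.
(* A negative factor exchanges the two nonnegative parts. *)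
have Nc0 : 0 <= - c by rewrite oppr_ge0.
have -> : (fun k => c * g k) = (fun k => - c * `|g k| - (- c) * (`|g k| + g k)).
  by apply: funext => k; rewrite -mulrBr opprD addrA subrr sub0r mulrNN.
rewrite rsum_sub; do ?exact: summableZ; do ?by move=> k _; rewrite mulr_ge0.
rewrite !esumZl// rsumE// !fineM ?esum_fin//.
by rewrite -mulrBr mulNr -mulrN opprB.
Qed.

Lemma rsum_le g : summable D (EFin \o g) ->
  ((rsum D g)%:E <= \esum_(k in D) `|g k|%:E)%E.
Proof.
move=> sg; have sg1 := summable_abs sg; have sg2 := summable_addabs sg.
rewrite rsumE// EFinB !fineK ?esum_fin// leeBlDr ?esum_fin// -esum_add//.
by apply: le_esum => k _; rewrite lee_fin lerD2l ler_norm.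
Qed.

Lemma abs_summable_Re z : abs_summable D z ->
  summable D (EFin \o (fun k => complex.Re (z k))).
Proof.
apply: le_lt_trans; apply: le_esum => k _ /=; rewrite lee_fin; exact: normRe_le.
Qed.

Lemma abs_summable_Im z : abs_summable D z ->
  summable D (EFin \o (fun k => complex.Im (z k))).
Proof.
apply: le_lt_trans; apply: le_esum => k _ /=; rewrite lee_fin; exact: normIm_le.
Qed.

Lemma abs_summable_le z w : (forall k, D k -> normc (z k) <= normc (w k)) ->
  abs_summable D w -> abs_summable D z.
Proof.
move=> zw; apply: le_lt_trans; apply: le_esum => k Dk; rewrite lee_fin; exact: zw.
Qed.

Lemma abs_summable0 : abs_summable D (fun=> 0 : R[i]).
Proof. by rewrite /abs_summable esum1// => k _; rewrite ComplexField.Normc.normc0. Qed.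

Lemma abs_summableD z w : abs_summable D z -> abs_summable D w ->
  abs_summable D (fun k => z k + w k).
Proof.
move=> sz sw; rewrite /abs_summable.
apply: (@le_lt_trans _ _ (\esum_(k in D) (normc (z k) + normc (w k))%:E)%E).
  by apply: le_esum => k _; rewrite lee_fin; exact: le_normcD.
rewrite esum_add; [exact: lte_add_pinfty|move=> k _; exact: normc_ge0..].
Qed.

Lemma abs_summableZ z c : abs_summable D z -> abs_summable D (fun k => c * z k).
Proof.
move=> sz; rewrite /abs_summable.
under eq_esum do rewrite ComplexField.Normc.normcM.
by rewrite esumZl ?normc_ge0// lte_mul_pinfty// lee_fin normc_ge0.
Qed.

Lemma csum0 : csum D (fun=> 0 : R[i]) = 0.
Proof.
have s0 : summable D (EFin \o (fun=> 0 : R)) by rewrite /summable esum1// => k _ /=; rewrite normr0.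
have r0 : rsum D (fun=> 0) = 0 :> R.
  by have := rsumZ 0 s0; rewrite !mul0r.
by rewrite /csum /= r0.
Qed.

Lemma csumD z w : abs_summable D z -> abs_summable D w ->
  csum D (fun k => z k + w k) = csum D z + csum D w.
Proof.
move=> sz sw; apply/eqP; rewrite eq_complex /= -!rsumD;
  [|exact: abs_summable_Im|exact: abs_summable_Im|exact: abs_summable_Re|exact: abs_summable_Re].
by apply/andP; split; apply/eqP; congr rsum; apply: funext => k;
  case: (z k) => ? ?; case: (w k).
Qed.

Lemma csumZ z c : abs_summable D z -> csum D (fun k => c * z k) = c * csum D z.
Proof.
move=> sz; case: c => a b.
have sr := abs_summable_Re sz; have si := abs_summable_Im sz.
apply/eqP; rewrite eq_complex /=; apply/andP; split; apply/eqP.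
  rewrite -!mulNr -!rsumZ// -rsumD; [|exact: summableZ|exact: summableZ].
  by congr rsum; apply: funext => k; case: (z k) => x y /=; rewrite mulNr.
rewrite -!rsumZ// -rsumD; [|exact: summableZ|exact: summableZ].
by congr rsum; apply: funext => k; case: (z k) => x y /=.
Qed.

Lemma abs_summable_sum (T : Type) (s : seq T) (c : T -> R[i]) (z : T -> I -> R[i]) :
  (forall t, abs_summable D (z t)) ->
  abs_summable D (fun k => \sum_(t <- s) c t * z t k).
Proof.
move=> sz; elim: s => [|t s IH].
  under eq_fun do rewrite big_nil; exact: abs_summable0.
under eq_fun do rewrite big_cons.
by apply: abs_summableD => //; exact: abs_summableZ.
Qed.

Lemma csum_sum (T : Type) (s : seq T) (c : T -> R[i]) (z : T -> I -> R[i]) :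
  (forall t, abs_summable D (z t)) ->
  csum D (fun k => \sum_(t <- s) c t * z t k) = \sum_(t <- s) c t * csum D (z t).
Proof.
move=> sz; elim: s => [|t s IH].
  by rewrite big_nil; under eq_fun do rewrite big_nil; exact: csum0.
rewrite big_cons -IH -csumZ// -csumD;
  [|exact: abs_summableZ|exact: abs_summable_sum].
by congr csum; apply: funext => k; rewrite big_cons.
Qed.

Lemma eq_rsum g h : (forall k, D k -> g k = h k) -> rsum D g = rsum D h.
Proof.
move=> gh; rewrite /rsum; congr (fine (_ - _)); apply: eq_esum => k Dk;
  by rewrite ?funeposE ?funenegE /= gh.
Qed.

Lemma eq_csum z w : (forall k, D k -> z k = w k) -> csum D z = csum D w.
Proof. by move=> zw; rewrite /csum; congr Complex; apply: eq_rsum => k Dk; rewrite zw. Qed.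

(** After a rotation the modulus of the sum is the real part of a sum, hence a real sum, whose terms
    are at most the moduli. *)
Lemma normc_csum z : abs_summable D z ->
  ((normc (csum D z))%:E <= \esum_(k in D) (normc (z k))%:E)%E.
Proof.
move=> sz; have [w w1 ->] := normc_rotation (csum D z).
rewrite -csumZ// /csum [complex.Re _]/=.
have sw : abs_summable D (fun k => w * z k) by exact: abs_summableZ.
apply: le_trans (rsum_le (abs_summable_Re sw)) _.
apply: le_esum => k _; rewrite lee_fin; apply: le_trans (normRe_le _) _.
by rewrite ComplexField.Normc.normcM w1 mul1r.
Qed.

End sums.

(** * Polynomials with complex coefficients, evaluated at real points *)

Section polynomials.
Context (R : realType) (n : nat).
Implicit Types (P Q : mpoly n R[i]) (x d u : 'rV[R]_n) (s t : seq 'I_n).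
Local Notation normc := ComplexField.Normc.normc.
Local Notation msize p := (mmeasure mdeg p).

Definition peval x P : R[i] := meval (fun i => real_complex R (x 0 i)) P.

Definition pderiv t P : mpoly n R[i] := foldr (@mderiv n _) P t.

(** The operator T_i: the partial derivative conjugated by the character. *)
Definition twist u i P : mpoly n R[i] := mderiv i P + Complex 0 (u 0 i) *: P.

Definition twists u s P : mpoly n R[i] := foldr (twist u) P s.

Definition affine (c : R) d : mpoly n R[i] :=
  mpolyC n (real_complex R c) +
  \sum_i real_complex R (d 0 i) *: mpolyX _ (mnm1 i).

Lemma pevalD x P Q : peval x (P + Q) = peval x P + peval x Q.
Proof. exact: mevalD. Qed.

Lemma pevalZ x a P : peval x (a *: P) = a * peval x P.
Proof. exact: mevalZ. Qed.

Lemma pevalM x P Q : peval x (P * Q) = peval x P * peval x Q.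
Proof. exact: mevalM. Qed.

Lemma peval_affine x c d :
  peval x (affine c d) = real_complex R (c + dotv x d).
Proof.
rewrite pevalD /peval mevalC raddf_sum rmorphD /dotv [in RHS]raddf_sum.
congr (_ + _); apply: eq_bigr => i _.
by rewrite /= mevalZ mevalXU rmorphM mulrC.
Qed.

Lemma pderivD t P Q : pderiv t (P + Q) = pderiv t P + pderiv t Q.
Proof. by elim: t => //= i t ->; rewrite mderivD. Qed.

Lemma pderivZ t a P : pderiv t (a *: P) = a *: pderiv t P.
Proof. by elim: t => //= i t ->; rewrite mderivZ. Qed.

Lemma peval_pderiv_sum x t (J : Type) (r : seq J) (c : J -> R[i]) (F : J -> mpoly n R[i]) :
  peval x (pderiv t (\sum_(j <- r) c j *: F j)) =
  \sum_(j <- r) c j * peval x (pderiv t (F j)).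
Proof.
elim/big_rec2: _ => [|j z q _ <-]; last by rewrite pderivD pderivZ pevalD pevalZ.
rewrite (_ : pderiv t 0 = 0); first by rewrite /peval meval0.
by elim: t => //= i t ->; rewrite mderiv0.
Qed.

Lemma pderiv_cat s t P : pderiv (s ++ t) P = pderiv s (pderiv t P).
Proof. exact: foldr_cat. Qed.

Lemma mderiv_affine i c d : mderiv i (affine c d) = mpolyC n (real_complex R (d 0 i)).
Proof.
rewrite /affine mderivD mderivC add0r raddf_sum /= (bigD1 i)//= big1 ?addr0.
  rewrite mderivZ mderivX mnm1E eqxx scale1r (_ : mnm_sub _ _ = mnm0); last first.
    by apply/mnmP => j; rewrite mnmBE subnn mnmE.
  by rewrite mpolyX0 -mul_mpolyC mulr1.
by move=> j ji; rewrite mderivZ mderivX mnm1E (negbTE ji) scale0r scaler0.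
Qed.

(** Each twist adds either one more derivative, still covered by [K] because the hypothesis ranges
    over all [t], or a factor of modulus at most [v]. *)
Lemma normc_pderiv_twists x u s P (K v : R) :
  (forall i, `|u 0 i| <= v) ->
  (forall t, normc (peval x (pderiv t P)) <= K) ->
  forall t, normc (peval x (pderiv t (twists u s P))) <= (1 + v) ^+ size s * K.
Proof.
move=> uv PK; elim: s => [|i s IH] t /=; first by rewrite expr0 mul1r.
rewrite /twist pderivD pderivZ pevalD pevalZ.
apply: le_trans (le_normcD _ _) _; rewrite exprS mulrDl mul1r mulrDl; apply: lerD.
  by rewrite -[mderiv i _]/(pderiv [:: i] _) -pderiv_cat.
rewrite ComplexField.Normc.normcM normc_imag -mulrA.
by apply: ler_pM => //; exact: normc_ge0.
Qed.

(* An affine factor absorbs at most one of the derivatives in [t]. *)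
Lemma normc_pderiv_affine x c d P (K delta : R) :
  (forall i, `|d 0 i| <= delta) ->
  (forall t, normc (peval x (pderiv t P)) <= K) ->
  forall t, normc (peval x (pderiv t (affine c d * P))) <=
            (`|c + dotv x d| + (size t)%:R * delta) * K.
Proof.
move=> dd PK t; elim/last_ind: t P PK => [|t i IH] P PK.
  rewrite mul0r addr0 /= pevalM peval_affine ComplexField.Normc.normcM normc_real.
  by rewrite ler_wpM2l//; exact: (PK [::]).
rewrite -cats1 pderiv_cat /= mderivM mderiv_affine mul_mpolyC pderivD pderivZ.
rewrite pevalD pevalZ; apply: le_trans (le_normcD _ _) _.
rewrite addrC ComplexField.Normc.normcM normc_real size_cat addn1 -natr1.
rewrite [X in _ <= (_ + X) * _]mulrDl mul1r addrA [X in _ <= X]mulrDl.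
apply: lerD; last by apply: ler_pM => //; exact: normc_ge0.
apply: IH => s; rewrite -[mderiv i _]/(pderiv [:: i] _) -pderiv_cat; exact: PK.
Qed.

(** [msize] is one more than the total degree, and 0 for the zero polynomial, which explains the
    strict and shifted bounds below. *)
Lemma msize_le k P :
  (msize P <= k)%N <-> (forall m, (k <= mdeg m)%N -> mcoeff m P = 0).
Proof.
split=> [Pk m km|Pk].
  by apply/eqP; rewrite mcoeff_eq0; apply: msize_mdeg_ge; exact: leq_trans km.
rewrite msizeE; apply/bigmax_leqP_seq => m mP _; rewrite ltnNge; apply/negP => /Pk.
by apply/eqP; rewrite -mcoeff_msupp.
Qed.

Lemma msize_mderiv i P : (msize (mderiv i P) <= (msize P).-1)%N.
Proof.
apply/msize_le => m Pm; rewrite mcoeff_mderiv (iffLR (msize_le _ P) (leqnn _)) ?mul0rn//.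
by rewrite mdegD mdeg1 addn1; case: (msize P) Pm.
Qed.

Lemma pderiv_eq0 t P : (msize P <= size t)%N -> pderiv t P = 0.
Proof.
elim/last_ind: t P => [|t i IH] P.
  by rewrite leqn0 mmeasure_poly_eq0 => /eqP.
rewrite size_rcons -cats1 pderiv_cat => Pt; apply: IH.
by apply: leq_trans (msize_mderiv _ _) _; case: (msize P) Pt.
Qed.

Lemma msize_twists u s P : (msize (twists u s P) <= msize P)%N.
Proof.
elim: s => //= i s IH; apply: leq_trans (mmeasureD_le _ _ _) _.
rewrite geq_max (leq_trans (msize_mderiv _ _))//=; last first.
  by apply: leq_trans (leq_pred _) _.
by apply: leq_trans (mmeasureZ_le _ _ _) _.
Qed.

Lemma msize_affine_mul c d P : (msize (affine c d * P) <= (msize P).+1)%N.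
Proof.
(* The exact size of a product, [msizeM], is for nonzero factors. *)
have [->|A0] := eqVneq (affine c d) 0; first by rewrite mul0r mmeasure0.
have [->|P0] := eqVneq P 0; first by rewrite mulr0 mmeasure0.
rewrite msizeM//; suff : (msize (affine c d) <= 2)%N.
  by case: (msize (affine c d)) => [|[|[|]]] //= _; rewrite ?add0n ?leqW// leq_pred.
apply: leq_trans (mmeasureD_le _ _ _) _; rewrite geq_max mmeasureC.
apply/andP; split; first by case: (_ != 0).
apply: leq_trans (mmeasure_sum _ _ _ _) _; apply/bigmax_leqP => i _.
by apply: leq_trans (mmeasureZ_le _ _ _) _; rewrite mmeasureX /= mdeg1.
Qed.

(** Induction on the size: a nonempty sequence of derivatives first applies one of the [n] partial
    derivatives, each of which lowers the degree, so finitely many bounds are added. This starts the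
    estimates with some [K], whose value is irrelevant for summability. *)
Lemma pderiv_bounded x P :
  exists K : R, forall t, normc (peval x (pderiv t P)) <= K.
Proof.
have [k] := ubnP (msize P); elim: k P => // k IH P Pk.
have [P0|P0] := posnP (msize P).
  exists 0 => t; rewrite pderiv_eq0 ?P0//.
  by rewrite /peval meval0 ComplexField.Normc.normc0.
have {}IH i : exists K : R, forall t, normc (peval x (pderiv t (mderiv i P))) <= K.
  apply: IH; apply: leq_ltn_trans (msize_mderiv _ _) _.
  by case: (msize P) P0 Pk.
have /choice[K HK] := IH.
have K0 i : 0 <= K i by apply: le_trans (normc_ge0 _) (HK i [::]).
exists (normc (peval x P) + \sum_i K i) => t.
case/lastP: t => [|t i]; first by rewrite lerDl sumr_ge0.
rewrite -cats1 pderiv_cat; apply: le_trans (HK i t) _.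
apply: le_trans (_ : \sum_j K j <= _); last by rewrite lerDr normc_ge0.
by rewrite (bigD1 i)//= lerDl sumr_ge0.
Qed.

Lemma peval0 P : peval 0 P = mcoeff mnm0 P.
Proof.
elim/mpolyind: P => [|c m p _ _ IH]; first by rewrite /peval meval0 mcoeff0.
rewrite pevalD pevalZ IH mcoeffD mcoeffZ; congr (_ * _ + _).
rewrite /peval mevalX mcoeffX; case: eqVneq => [->|m0].
  by rewrite big1// => i _; rewrite mnmE expr0.
have [i mi] : exists i, m i != 0%N.
  apply/existsP; rewrite -negb_forall; apply: contra m0 => /forallP m0.
  by apply/eqP/mnmP => i; rewrite (eqP (m0 i)) mnmE.
rewrite (bigD1 i)//= mxE expr0n (negbTE mi) mul0r//.
Qed.

Lemma multinom_ind (Q : multinom n -> Prop) :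
  Q mnm0 -> (forall i m, Q m -> Q (mnm_add m (mnm1 i))) -> forall m, Q m.
Proof.
move=> Q0 QS m; have [k] := ubnP (mdeg m); elim: k m => // k IH m mk.
have [->//|m0] := eqVneq m mnm0.
have [i mi] : exists i, m i != 0%N.
  apply/existsP; rewrite -negb_forall; apply: contra m0 => /forallP m0.
  by apply/eqP/mnmP => i; rewrite (eqP (m0 i)) mnmE.
have em : m = mnm_add (mnm_sub m (mnm1 i)) (mnm1 i) by rewrite submK// lep1mP.
rewrite em; apply: QS; apply: IH.
by move: mk; rewrite [in X in X -> _]em mdegD mdeg1 addn1.
Qed.

(** By Taylor's formula at the origin, the coefficient is a derivative of order [mdeg m] divided by
    a product of factorials. The induction peels off one derivative, which multiplies the
    coefficient by a positive integer. *)
Lemma normc_mcoeff m P (K : R) :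
  (forall t, size t = mdeg m -> normc (peval 0 (pderiv t P)) <= K) ->
  normc (mcoeff m P) <= K.
Proof.
elim/multinom_ind: m P => [|i m IH] P PK.
  by rewrite -peval0; apply: (PK [::]); rewrite mdeg0.
apply: (@le_trans _ _ (normc (mcoeff m (mderiv i P)))).
  by rewrite mcoeff_mderiv normcMn -mulr_natr ler_peMr ?normc_ge0// ler1n.
apply: IH => t tm; rewrite -[mderiv i _]/(pderiv [:: i] _) -pderiv_cat; apply: PK.
by rewrite size_cat tm mdegD mdeg1.
Qed.

End polynomials.

(** * Derivatives of a character times a polynomial *)

Section complex_derivatives.
Context (R : realType) (n : nat).
Implicit Types (f g : 'rV[R]_n -> R) (F G : 'rV[R]_n -> R[i]) (x u : 'rV[R]_n).
Implicit Types (P : mpoly n R[i]) (s : seq 'I_n) (X : set 'rV[R]_n).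

(** Differentiability is carried along with the partial derivatives: it provides continuity and the
    chain rule, which partial derivatives alone do not. *)
Definition rgrad f x (df : 'I_n -> R) :=
  differentiable f x /\ forall i, is_derive x (delta_mx 0 i) f (df i).

Definition cgrad F x (dF : 'I_n -> R[i]) :=
  rgrad (fun y => complex.Re (F y)) x (fun i => complex.Re (dF i)) /\
  rgrad (fun y => complex.Im (F y)) x (fun i => complex.Im (dF i)).

Lemma rgrad_eq f g x df dg :
  rgrad f x df -> f =1 g -> df =1 dg -> rgrad g x dg.
Proof. by move=> fdf /funext <- /funext <-. Qed.

Lemma rgrad_cst (c : R) x : rgrad (fun=> c) x (fun=> 0).
Proof. by split=> [|i]; [exact: differentiable_cst|exact: is_derive_cst]. Qed.

Lemma rgradD f g x df dg : rgrad f x df -> rgrad g x dg ->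
  rgrad (fun y => f y + g y) x (fun i => df i + dg i).
Proof.
by move=> [f1 f2] [g1 g2]; split=> [|i]; [exact: differentiableD|exact: is_deriveD].
Qed.

Lemma rgradB f g x df dg : rgrad f x df -> rgrad g x dg ->
  rgrad (fun y => f y - g y) x (fun i => df i - dg i).
Proof.
by move=> [f1 f2] [g1 g2]; split=> [|i]; [exact: differentiableB|exact: is_deriveB].
Qed.

Lemma rgradM f g x df dg : rgrad f x df -> rgrad g x dg ->
  rgrad (fun y => f y * g y) x (fun i => f x * dg i + g x * df i).
Proof.
by move=> [f1 f2] [g1 g2]; split=> [|i]; [exact: differentiableM|exact: is_deriveM].
Qed.

Lemma rgrad_coord j x : rgrad (fun y => y 0 j) x (fun i => (i == j)%:R).
Proof.
have dj := @differentiable_coord R 1 n x 0 j; split=> // i.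
apply: DeriveDef; first exact: diff_derivable.
rewrite /derive; apply: cvg_lim => //.
(* For a nonzero increment the difference quotient is already constant. *)
apply: (@cvg_trans _ ((fun=> (i == j)%:R : R) @ (0 : R)^')); last exact: cvg_cst.
apply: near_eq_cvg; near=> h; rewrite /= !mxE eqxx addrK /= eq_sym.
rewrite -[_ *: _]/(_ * _) mulrA mulVf ?mul1r//.
by near: h; exact: nbhs_dnbhs_neq.
Unshelve. all: by end_near. Qed.

Lemma rgrad_sum (T : Type) (r : seq T) (f : T -> 'rV[R]_n -> R) x (df : T -> 'I_n -> R) :
  (forall t, rgrad (f t) x (df t)) ->
  rgrad (fun y => \sum_(t <- r) f t y) x (fun i => \sum_(t <- r) df t i).
Proof.
move=> fdf; elim: r => [|t r IH].
  by apply: rgrad_eq (rgrad_cst 0 x) _ _ => ?; rewrite big_nil.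
by apply: rgrad_eq (rgradD (fdf t) IH) _ _ => ?; rewrite big_cons.
Qed.

Lemma rgrad_comp f (h : R -> R) x df (dh : R) :
  rgrad f x df -> is_derive (f x) 1 h dh ->
  rgrad (fun y => h (f y)) x (fun i => dh * df i).
Proof.
move=> [f1 f2] hh; have h1 : differentiable h (f x).
  by apply/derivable1_diffP; case: hh.
have hf : differentiable (h \o f) x by exact: differentiable_comp.
split=> // i; apply: DeriveDef; first exact: diff_derivable.
rewrite deriveE// diff_comp//= diff1E// -deriveE// derive1E.
by case: hh => _ ->; case: (f2 i) => _ ->; rewrite mulrC.
Qed.

Lemma rgrad_dotv u x : rgrad (dotv u) x (fun i => u 0 i).
Proof.
have := @rgrad_sum _ (index_enum 'I_n) (fun j y => u 0 j * y 0 j) x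
  (fun j i => u 0 j * (i == j)%:R + x 0 j * 0)
  (fun j => rgradM (rgrad_cst (u 0 j) x) (rgrad_coord j x)).
congr (rgrad _ _ _); apply: funext => i.
rewrite (bigD1 i)//= eqxx mulr1 mulr0 addr0 big1 ?addr0// => j ji.
by rewrite eq_sym (negbTE ji) !mulr0 addr0.
Qed.

Lemma cgrad_cst (c : R[i]) x : cgrad (fun=> c) x (fun=> 0).
Proof. by split; exact: rgrad_cst. Qed.

Lemma cgrad_eq F G x dF dG :
  cgrad F x dF -> F =1 G -> dF =1 dG -> cgrad G x dG.
Proof. by move=> FdF /funext <- /funext <-. Qed.

Lemma ReD (a b : R[i]) : complex.Re (a + b) = complex.Re a + complex.Re b.
Proof. by case: a; case: b. Qed.

Lemma ImD (a b : R[i]) : complex.Im (a + b) = complex.Im a + complex.Im b.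
Proof. by case: a; case: b. Qed.

Lemma ReM (a b : R[i]) : complex.Re (a * b) =
  complex.Re a * complex.Re b - complex.Im a * complex.Im b.
Proof. by case: a; case: b. Qed.

Lemma ImM (a b : R[i]) : complex.Im (a * b) =
  complex.Re a * complex.Im b + complex.Im a * complex.Re b.
Proof. by case: a; case: b. Qed.

Lemma cgradD F G x dF dG : cgrad F x dF -> cgrad G x dG ->
  cgrad (fun y => F y + G y) x (fun i => dF i + dG i).
Proof.
move=> [F1 F2] [G1 G2]; split.
  by apply: rgrad_eq (rgradD F1 G1) _ _ => ?; rewrite ReD.
by apply: rgrad_eq (rgradD F2 G2) _ _ => ?; rewrite ImD.
Qed.

Lemma cgradM F G x dF dG : cgrad F x dF -> cgrad G x dG ->
  cgrad (fun y => F y * G y) x (fun i => F x * dG i + dF i * G x).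
Proof.
move=> [F1 F2] [G1 G2]; split.
  apply: rgrad_eq (rgradB (rgradM F1 G1) (rgradM F2 G2)) _ _ => i; rewrite ?ReM//.
  rewrite ReD !ReM; case: (F x) (G x) (dF i) (dG i) => a b [c d] [a' b'] [c' d'] /=.
  by rewrite opprD addrACA [c * a']mulrC [d * b']mulrC.
apply: rgrad_eq (rgradD (rgradM F1 G2) (rgradM F2 G1)) _ _ => i; rewrite ?ImM//.
rewrite ImD !ImM; case: (F x) (G x) (dF i) (dG i) => a b [c d] [a' b'] [c' d'] /=.
by rewrite addrACA [d * a']mulrC [c * b']mulrC.
Qed.

(** Monomials follow from the product rule, one variable at a time; general polynomials follow by
    linearity. *)
Lemma cgrad_peval P x :
  cgrad (fun y => peval y P) x (fun i => peval x (mderiv i P)).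
Proof.
have pX m : cgrad (fun y => peval y (mpolyX _ m)) x (fun i => peval x (mderiv i (mpolyX _ m))).
  elim/multinom_ind: m => [|j m IH].
    apply: cgrad_eq (cgrad_cst 1 x) _ _ => i; rewrite mpolyX0 /peval ?meval1//.
    by rewrite -mpolyC1 mderivC meval0.
  have cj : cgrad (fun y => peval y (mpolyX _ (mnm1 j))) x (fun i => (i == j)%:R).
    split.
      apply: rgrad_eq (rgrad_coord j x) _ _ => i; rewrite ?/peval ?mevalXU//.
      by case: (i == j).
    apply: rgrad_eq (rgrad_cst 0 x) _ _ => i; rewrite ?/peval ?mevalXU//.
    by case: (i == j).
  apply: cgrad_eq (cgradM IH cj) _ _ => i; first by rewrite mpolyXD pevalM.
  rewrite mpolyXD mderivM pevalD !pevalM addrC; congr (_ + _ * _).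
  rewrite mderivX mnm1E eq_sym; case: eqVneq => [->|_]; last by rewrite scale0r /peval meval0.
  rewrite scale1r (_ : mnm_sub _ _ = mnm0) ?mpolyX0 /peval ?meval1//.
  by apply/mnmP => k; rewrite mnmBE subnn mnmE.
elim/mpolyind: P => [|c m p _ _ IH].
  by apply: cgrad_eq (cgrad_cst 0 x) _ _ => i; rewrite ?mderiv0 /peval meval0.
apply: cgrad_eq (cgradD (cgradM (cgrad_cst c x) (pX m)) IH) _ _ => i.
  by rewrite pevalD pevalZ.
by rewrite mul0r addr0 mderivD mderivZ pevalD pevalZ.
Qed.

Lemma cgrad_character u x :
  cgrad (character u) x (fun i => Complex 0 (u 0 i) * character u x).
Proof.
have du := rgrad_dotv u x.
split; rewrite /character /=.
  have := rgrad_comp du (is_derive_cos (dotv u x)); congr (rgrad _ _ _).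
  by apply: funext => i; rewrite mul0r sub0r mulNr mulrC.
have := rgrad_comp du (is_derive_sin (dotv u x)); congr (rgrad _ _ _).
by apply: funext => i; rewrite mul0r add0r mulrC.
Qed.

Definition expoly u P x : R[i] := character u x * peval x P.

(** The product rule: differentiating the character yields the second summand of [twist]. *)
Lemma cgrad_expoly u P x :
  cgrad (expoly u P) x (fun i => expoly u (twist u i P) x).
Proof.
apply: cgrad_eq (cgradM (cgrad_character u x) (cgrad_peval P x)) _ _ => i //.
by rewrite /expoly /twist pevalD pevalZ mulrDr [in RHS]mulrCA mulrA.
Qed.

(** Stated as equalities of functions, so that the next derivative can be taken by rewriting. *)
Lemma iter_partial_expoly u s P :
  iter_partial s (fun y => complex.Re (expoly u P y)) =
    (fun y => complex.Re (expoly u (twists u s P) y)) /\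
  iter_partial s (fun y => complex.Im (expoly u P y)) =
    (fun y => complex.Im (expoly u (twists u s P) y)).
Proof.
elim: s => //= i s [-> ->]; split; apply: funext => y; rewrite /partial;
  have [[_ Re_d] [_ Im_d]] := cgrad_expoly u (twists u s P) y.
- by case: (Re_d i).
- by case: (Im_d i).
Qed.

Lemma smooth_expoly X u P :
  smooth_on X (fun y => complex.Re (expoly u P y)) /\
  smooth_on X (fun y => complex.Im (expoly u P y)).
Proof.
split=> s x _; have [Re_s Im_s] := iter_partial_expoly u s P;
  have [[dRe _] [dIm _]] := cgrad_expoly u (twists u s P) x.
- rewrite Re_s; split; first exact: differentiable_continuous.
  by move=> i; exact: diff_derivable.
- rewrite Im_s; split; first exact: differentiable_continuous.
  by move=> i; exact: diff_derivable.
Qed.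

(** An open set is a neighbourhood of each of its points, and derivatives are local. Iterates of the
    operator are identified on [X] only, so their derivatives are computed through this lemma. *)
Lemma eq_iter_partial X f g s : open X -> (forall x, X x -> f x = g x) ->
  forall x, X x -> iter_partial s f x = iter_partial s g x.
Proof.
move=> oX fg; elim: s => //= i s IH x Xx; apply: near_eq_derive.
by apply: filterS (open_nbhs_nbhs (conj oX Xx)).
Qed.

Lemma eq_smooth_on X f g : open X -> (forall x, X x -> f x = g x) ->
  smooth_on X g -> smooth_on X f.
Proof.
move=> oX fg sg s x Xx; have [cg dg] := sg s x Xx.
have near_gf : \forall y \near x, iter_partial s g y = iter_partial s f y.
  apply: filterS (open_nbhs_nbhs (conj oX Xx)) => y Xy.
  by rewrite (eq_iter_partial s oX fg).
split; last by move=> i; exact: near_eq_derivable (dg i).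
suff : iter_partial s f y @[y --> x] --> iter_partial s f x by [].
rewrite (eq_iter_partial s oX fg Xx).
by apply: cvg_trans cg; exact: near_eq_cvg near_gf.
Qed.

End complex_derivatives.

(** * Infinite sums of polynomials of bounded degree *)

Section polynomial_sums.
Context (R : realType) (n : nat) (I : choiceType) (D : set I) (N : nat).
Variable p : I -> mpoly n R[i].
Local Notation normc := ComplexField.Normc.normc.
Local Notation msize p := (mmeasure mdeg p).

(** The coefficientwise sum. The index type [bmultinom n N] holds the finitely many exponents of
    degree below [N]. *)
Definition psum : mpoly n R[i] :=
  \sum_(m : bmultinom n N) csum D (fun k => mcoeff m (p k)) *: mpolyX _ m.

Lemma msize_psum : (msize psum <= N)%N.
Proof.
apply: leq_trans (mmeasure_sum _ _ _ _) _; apply/bigmax_leqP => m _.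
by apply: leq_trans (mmeasureZ_le _ _ _) _; rewrite mmeasureX; exact: bmdeg.
Qed.

Hypothesis size_p : forall k, D k -> (msize (p k) <= N)%N.
Hypothesis summable_p : forall m, abs_summable D (fun k => mcoeff m (p k)).

Let ell x t (m : multinom n) := peval x (pderiv t (mpolyX R[i] m)).

Let peval_sum x t k : D k -> peval x (pderiv t (p k)) =
  \sum_(m : bmultinom n N) ell x t m * mcoeff m (p k).
Proof.
move=> Dk; have -> : peval x (pderiv t (p k)) = peval x (pderiv t
  (\sum_(m : bmultinom n N) mcoeff m (p k) *: mpolyX _ m)) by rewrite -mpolywE ?size_p.
by rewrite peval_pderiv_sum; apply: eq_bigr => m _; rewrite mulrC.
Qed.

Lemma abs_summable_peval x t : abs_summable D (fun k => peval x (pderiv t (p k))).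
Proof.
have := @abs_summable_sum _ _ D _ (index_enum (bmultinom n N)) (fun m => ell x t m) _
  (fun m => summable_p m).
by apply: abs_summable_le => k Dk; rewrite peval_sum.
Qed.

(** On polynomials of size at most [N] the functional is a fixed finite linear combination of
    coefficients, so only finite linearity of [csum] enters, and no interchange of limits. *)
Lemma peval_psum x t :
  peval x (pderiv t psum) = csum D (fun k => peval x (pderiv t (p k))).
Proof.
rewrite (eq_csum (fun k => @peval_sum x t k)) csum_sum//.
by rewrite peval_pderiv_sum; apply: eq_bigr => m _; rewrite mulrC.
Qed.

End polynomial_sums.

(** * Counting multi-indices of a given degree *)

Lemma bin_le_exp2 k j : ('C(k, j) <= 2 ^ k)%N.
Proof.
have [kj|jk] := ltnP k j; first by rewrite bin_small.
have -> : (2 ^ k = \sum_(i < k.+1) 'C(k, i))%N.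
  by rewrite -[2%N]/(1 + 1)%N expnDn; apply: eq_bigr => i _; rewrite !exp1n !muln1.
by rewrite (bigD1 (Ordinal (n:=k.+1) (m:=j) jk))//= leq_addr.
Qed.

Section counting.
Context (R : realType) (n : nat).
Local Open Scope ereal_scope.

(** Stars and bars: with [n = m + 1] there are ['C(m + k, m)] multi-indices of degree [k], and a
    binomial coefficient is at most a power of 2. *)
Lemma size_mdegree k (s : seq (multi_index n)) : (0 < n)%N -> uniq s ->
  (forall alpha, alpha \in s -> mdegree alpha = k) -> (size s <= 2 ^ (n + k))%N.
Proof.
case: n s => // m s _ us sk.
pose f (alpha : multi_index m.+1) := [tuple (inord (alpha i) : 'I_k.+1) | i < m.+1].
have le_k alpha i : alpha \in s -> (alpha i < k.+1)%N.
  by move=> /sk <-; rewrite ltnS /mdegree (bigD1 i)//= leq_addr.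
have inj_f : {in s &, injective f}.
  move=> al be als bes fE; apply/ffunP => i.
  have := congr1 (fun t => nat_of_ord (tnth t i)) fE; rewrite !tnth_mktuple !inordK//; exact: le_k.
rewrite -(size_map f); have uf : uniq (map f s) by rewrite map_inj_in_uniq.
rewrite -(card_uniqP uf).
apply: (@leq_trans
    #|finset (fun t : m.+1.-tuple 'I_k.+1 => \sum_(i <- t) i == k)%N|).
  apply: subset_leq_card; apply/fintype.subsetP => _ /mapP[al als ->]; rewrite inE.
  rewrite big_tuple -[X in _ == X](sk _ als); apply/eqP; apply: eq_bigr => i _.
  by rewrite tnth_mktuple inordK// le_k.
rewrite card_ord_partitions; apply: leq_trans (bin_le_exp2 _ _) _.
by rewrite leq_exp2l// addSn.
Qed.

Lemma sume_const (T : Type) (s : seq T) (P : pred T) (y : \bar R) : 0 <= y ->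
  \sum_(t <- s | P t) y = (count P s)%:R%:E * y.
Proof.
move=> y0; elim: s => [|t s IH]; first by rewrite big_nil mul0e.
rewrite big_cons /= IH natrD EFinD ge0_muleDl ?lee_fin//.
by case: (P t); rewrite ?mul1e// mul0e add0e.
Qed.

(** Each finite partial sum is grouped by degree, and each group is counted. This is the source of
    the factors [2 ^+ n] in the theorem and [2 ^+ k] in [theta]. *)
Lemma esum_mdegree (g : nat -> \bar R) : (0 < n)%N ->
  (forall k, 0 <= g k) ->
  \esum_(alpha in @nonzero_index n) g (mdegree alpha) <=
  (2 ^+ n)%:E * \sum_(1 <= k <oo) (2 ^+ k)%:E * g k.
Proof.
move=> n0 g0; apply: ge_ereal_sup => _ [F [finF FN] <-].
rewrite fsbig_finite//=; set s := enum_fset (fset_set F).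
have s0 alpha : alpha \in s -> (0 < mdegree alpha)%N.
  by rewrite -[_ \in s]/(alpha \in fset_set F) in_fset_set// inE => /FN.
pose M := (\max_(alpha <- s) mdegree alpha).+1.
have sM alpha : alpha \in s -> (mdegree alpha < M)%N.
  by move=> als; rewrite ltnS (big_rem alpha)//= leq_maxl.
(* Each term becomes a sum over degrees with one nonzero index, so that exchanging the sums performs
   the grouping. *)
have -> : \sum_(alpha <- s) g (mdegree alpha) =
  \sum_(alpha <- s) \sum_(1 <= k < M | k == mdegree alpha) g k.
  apply: eq_big_seq => alpha als.
  by rewrite big_nat1_eq s0// sM.
rewrite (exchange_big_dep predT)//=.
apply: (@le_trans _ _ (\sum_(1 <= k < M) (2 ^+ n)%:E * ((2 ^+ k)%:E * g k))).
  rewrite big_nat [leRHS]big_nat; apply: lee_sum => k /andP[k0 kM].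
  rewrite sume_const ?g0// muleA -EFinM.
  apply: lee_wpmul2r; first exact: g0.
  rewrite lee_fin -exprD -natrX ler_nat -size_filter; apply: size_mdegree => //.
    by rewrite filter_uniq// fset_uniq.
  by move=> alpha; rewrite mem_filter => /andP[/eqP->].
have g20 k : 0 <= (2 ^+ k)%:E * g k by rewrite mule_ge0// lee_fin exprn_ge0.
rewrite -nneseriesZl//; apply: nneseries_lim_ge => k _ _.
by rewrite mule_ge0// lee_fin exprn_ge0.
Qed.

End counting.

(** * Coordinates and the maximum norm *)

Section row_vectors.
Context (R : realType) (n : nat).
Implicit Types (x : 'rV[R]_n).

Lemma coord_le_norm x i : `|x 0 i| <= `|x|.
Proof.
rewrite [leRHS]mx_normrE; apply: (@le_trans _ _ `|x (0, i).1 (0, i).2|) => //.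
exact: le_bigmax.
Qed.

Lemma norm_le_coord x (r : R) : 0 <= r -> (forall i, `|x 0 i| <= r) -> `|x| <= r.
Proof.
by move=> r0 xr; rewrite [leLHS]mx_normrE; apply: bigmax_le => // -[j i] _; rewrite (ord1 j).
Qed.

End row_vectors.

(** * Multi-indices as sequences of directions *)

Section multi_indices.
Context (R : realType) (n : nat).
Implicit Types (alpha : multi_index n) (i : 'I_n).

Definition index_seq alpha : seq 'I_n :=
  flatten [seq nseq (alpha i) i | i <- enum 'I_n].

Definition unit_index i : multi_index n := [ffun j => nat_of_bool (j == i)].

Lemma size_index_seq alpha : size (index_seq alpha) = mdegree alpha.
Proof.
rewrite size_flatten /shape -map_comp sumnE big_map big_enum.
by apply: eq_bigr => i _; rewrite /= size_nseq.
Qed.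

Lemma mdegree_unit i : mdegree (unit_index i) = 1%N.
Proof.
rewrite /mdegree (bigD1 i)//= ffunE eqxx big1// => j /negbTE ji.
by rewrite ffunE ji.
Qed.

Lemma index_seq_unit i : index_seq (unit_index i) = [:: i].
Proof.
have := size_index_seq (unit_index i); rewrite mdegree_unit.
case E : (index_seq _) => [|j [|]]// _; congr [:: _].
have : j \in index_seq (unit_index i) by rewrite E mem_head.
case/flattenP => _ /mapP[k _ ->]; rewrite mem_nseq ffunE.
by case: eqVneq => //= -> /eqP.
Qed.

End multi_indices.

(** * Summability of the affine coefficients *)

Section coefficients.
Context (R : realType) (n : nat) (X : set 'rV[R]_n).
Variable a : multi_index n -> 'rV[R]_n -> R.
Implicit Types (alpha beta : multi_index n) (x u : 'rV[R]_n).
Local Notation normc := ComplexField.Normc.normc.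
Local Notation nz := (@nonzero_index n).

Lemma coef_bound_ge alpha beta x : X x -> (mdegree beta <= 1)%N ->
  ((`|mpartial beta (a alpha) x| / (1 + `|x|))%:E <= coef_bound X a (mdegree alpha))%E.
Proof.
move=> Xx b1; apply: le_trans (ereal_sup_ubound _); last by exists x.
by apply: ereal_sup_ubound; exists (alpha, beta).
Qed.

(** A supremum over the empty set would be -oo. A positive dimension gives a multi-index of every
    degree [k], concentrated in the first coordinate. *)
Lemma coef_bound_ge0 k : (0 < n)%N -> X !=set0 -> (0 <= coef_bound X a k)%E.
Proof.
move=> n0 [x Xx]; pose alpha : multi_index n := [ffun j => if j == Ordinal n0 then k else 0%N].
have <- : mdegree alpha = k.
  rewrite /mdegree (bigD1 (Ordinal n0))//= ffunE eqxx big1 ?addn0// => j /negbTE ji.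
  by rewrite ffunE ji.
apply: le_trans (@coef_bound_ge alpha [ffun=> 0%N] x Xx _).
  by rewrite lee_fin divr_ge0// addr_ge0.
by rewrite /mdegree big1// => i _; rewrite ffunE.
Qed.

(** Constant vectors [u] turn the convergence hypothesis into summability against every geometric
    weight in the degree. *)
Lemma normc_symbol_term u x alpha (C : R) : (forall i, u 0 i = C) ->
  normc (symbol_term a u x alpha) = `|a alpha x| * `|C| ^+ mdegree alpha.
Proof.
move=> uC; rewrite ComplexField.Normc.normcM normc_real normc_prod; congr (_ * _).
rewrite /mdegree -prodrXr; apply: eq_bigr => i _.
by rewrite normcX normc_imag uC.
Qed.

Context (c : multi_index n -> R) (d : multi_index n -> 'rV[R]_n).
Hypothesis hn0 : (0 < n)%N.
Hypothesis oX : open X.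
Hypothesis ha : forall alpha, (0 < mdegree alpha)%N ->
  forall x, X x -> a alpha x = c alpha + dotv x (d alpha).
Hypothesis hconv : forall u x, X x -> abs_summable nz (symbol_term a u x).

Lemma partial_coef alpha x i : (0 < mdegree alpha)%N -> X x ->
  partial i (a alpha) x = d alpha 0 i.
Proof.
move=> al0 Xx; rewrite /partial.
rewrite (@near_eq_derive _ _ _ _ (fun y => c alpha + dotv (d alpha) y)).
  have [_ dg] := rgradD (rgrad_cst (c alpha) x) (rgrad_dotv (d alpha) x).
  by case: (dg i) => _ ->; rewrite add0r.
apply: filterS (open_nbhs_nbhs (conj oX Xx)) => y Xy; rewrite ha//.
by congr (_ + _); apply: eq_bigr => j _; rewrite mulrC.
Qed.

Lemma summable_a x (C : R) : X x -> 0 <= C ->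
  summable nz (EFin \o (fun alpha => a alpha x * C ^+ mdegree alpha)).
Proof.
move=> Xx C0; have := hconv (const_mx C) Xx.
apply: le_lt_trans; apply: le_esum => alpha _ /=.
rewrite (@normc_symbol_term _ x alpha C); last by move=> i; rewrite mxE.
by rewrite normrM normrX.
Qed.

(* [d alpha 0 i] is a difference quotient of [a alpha] between two points of X. *)
Lemma summable_d x i (C : R) : X x -> 0 <= C ->
  summable nz (EFin \o (fun alpha => d alpha 0 i * C ^+ mdegree alpha)).
Proof.
move=> Xx C0.
(* The increment is half the radius of a ball around [x] inside [X]. *)
have [e e0 Xe] : exists2 e : R, 0 < e & X (x + e *: delta_mx 0 i).
  have /nbhs_ballP[e /= e0 eX] := open_nbhs_nbhs (conj oX Xx).
  exists (e / 2); first by rewrite divr_gt0.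
  apply: eX; rewrite -ball_normE /= opprD addrA subrr sub0r normrN normrZ.
  rewrite gtr0_norm ?divr_gt0//.
  apply: (@le_lt_trans _ _ (e / 2 * 1)); last by rewrite mulr1 ltr_pdivrMr// ltr_pMr// ltr1n.
  rewrite ler_pM2l ?divr_gt0//; apply: norm_le_coord => // j.
  by rewrite mxE eqxx /=; case: (j == i); rewrite ?normr1 ?normr0.
have := summableZ e^-1 (summable_add (summable_a Xe C0)
  (summableZ (-1) (summable_a Xx C0))).
apply: summable_le => alpha al0; rewrite mulN1r -mulrBl mulrA.
rewrite !ha//= opprD addrACA subrr add0r.
suff -> : dotv (x + e *: delta_mx 0 i) (d alpha) - dotv x (d alpha) = e * d alpha 0 i.
  by rewrite mulrA mulVf ?gt_eqF// mul1r.
rewrite /dotv -sumrB (bigD1 i)//= big1 => [|j ji]; last first.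
  by rewrite !mxE eqxx /= (negbTE ji) mulr0 addr0 subrr.
by rewrite !mxE !eqxx /= mulr1 addr0 mulrDl addrC addKr.
Qed.

Lemma summable_dnorm x (C : R) : X x -> 0 <= C ->
  summable nz (EFin \o (fun alpha => `|d alpha| * C ^+ mdegree alpha)).
Proof.
move=> Xx C0.
have := summable_fsum (index_enum 'I_n)
  (fun i => summable_abs (summable_d i Xx C0)).
apply: summable_le => alpha _.
rewrite normrM normr_id (ger0_norm (sumr_ge0 _ _))//.
under eq_bigr do rewrite normrM.
rewrite -mulr_suml ler_wpM2r//; apply: norm_le_coord; first exact: sumr_ge0.
by move=> i; rewrite (bigD1 i)//= lerDl sumr_ge0.
Qed.

(** The constant term is the value at [x] minus the linear part, and both are already summable. *)
Lemma summable_c x (C : R) : X x -> 0 <= C ->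
  summable nz (EFin \o (fun alpha => c alpha * C ^+ mdegree alpha)).
Proof.
move=> Xx C0; have := summable_add (summable_a Xx C0)
  (summable_fsum (index_enum 'I_n) (fun i => summableZ (- x 0 i) (summable_d i Xx C0))).
apply: summable_le => alpha al0; rewrite ha//.
under [in leRHS]eq_bigr do rewrite mulNr mulrA.
by rewrite sumrN -mulr_suml -mulrBl addrK.
Qed.

Lemma summable_affine x (K C : R) j : X x -> 0 <= C ->
  summable nz (EFin \o (fun alpha =>
    (`|c alpha| + j%:R * `|d alpha|) * (C ^+ mdegree alpha * K))).
Proof.
move=> Xx C0; have := summableZ K (summable_add (summable_abs (summable_c Xx C0))
  (summableZ j%:R (summable_dnorm Xx C0))).
apply: summable_le => alpha _.
rewrite (normrM (c alpha)) (ger0_norm (exprn_ge0 _ C0)).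
by rewrite [j%:R * (_ * _)]mulrA -mulrDl [K * _]mulrC mulrA.
Qed.

(** * The operator on a character times a polynomial *)

Definition term_poly u (P : mpoly n R[i]) alpha : mpoly n R[i] :=
  affine (c alpha) (d alpha) * twists u (index_seq alpha) P.

(** Coefficients are bounded by derivatives at the origin, where the affine factor reduces to
    [c alpha]. The origin may lie outside [X]: the polynomials live on the whole space, and the
    point of [X] serves only for the summability of [c] and [d]. *)
Lemma summable_term_poly u P m : X !=set0 ->
  abs_summable nz (fun alpha => mcoeff m (term_poly u P alpha)).
Proof.
move=> [x Xx]; have [K PK] := pderiv_bounded 0 P.
have u0 : 0 <= 1 + `|u| by rewrite addr_ge0.
have := summable_affine K (mdeg m) Xx u0; apply: le_lt_trans.
apply: le_esum => alpha _; rewrite lee_fin; apply: le_trans _ (ler_norm _).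
apply: normc_mcoeff => t <-; rewrite -size_index_seq.
have := normc_pderiv_affine (c alpha) (fun i => coord_le_norm (d alpha) i)
  (fun t => normc_pderiv_twists (index_seq alpha) (fun i => coord_le_norm u i) PK t) t.
by rewrite /dotv big1 ?addr0// => i _; rewrite mxE mul0r.
Qed.

Lemma operator_term_expoly F u P x alpha : X x -> (0 < mdegree alpha)%N ->
  (forall y, X y -> F y = expoly u P y) ->
  operator_term a F x alpha = character u x * peval x (term_poly u P alpha).
Proof.
move=> Xx al0 FP; rewrite pevalM peval_affine -ha// mulrCA; congr (_ * _).
have [Re_s Im_s] := iter_partial_expoly u (index_seq alpha) P.
rewrite /cmpartial /mpartial -/(index_seq alpha).
have FRe y : X y -> complex.Re (F y) = complex.Re (expoly u P y) by move=> /FP ->.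
have FIm y : X y -> complex.Im (F y) = complex.Im (expoly u P y) by move=> /FP ->.
rewrite (eq_iter_partial _ oX FRe Xx) (eq_iter_partial _ oX FIm Xx).
by rewrite Re_s Im_s -/(expoly _ _ _); case: (expoly _ _ _).
Qed.

Definition next_poly u (P : mpoly n R[i]) : mpoly n R[i] :=
  psum nz (mmeasure mdeg P).+1 (term_poly u P).

Lemma size_term_poly u P alpha :
  (mmeasure mdeg (term_poly u P alpha) <= (mmeasure mdeg P).+1)%N.
Proof. by apply: leq_trans (msize_affine_mul _ _ _) _; rewrite ltnS msize_twists. Qed.

Lemma abs_summable_operator F u P x : X x ->
  (forall y, X y -> F y = expoly u P y) -> abs_summable nz (operator_term a F x).
Proof.
move=> Xx FP; have := abs_summableZ (character u x) (@abs_summable_peval _ _ _ nz _ _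
  (fun k _ => size_term_poly u P k)
  (fun m => summable_term_poly u P m (ex_intro _ _ Xx)) x [::]).
by apply: abs_summable_le => alpha al0; rewrite (operator_term_expoly Xx al0 FP).
Qed.

Lemma operator_expoly F u P x : X x ->
  (forall y, X y -> F y = expoly u P y) ->
  operator a F x = expoly u (next_poly u P) x.
Proof.
move=> Xx FP; have X0 : X !=set0 by exists x.
rewrite /operator (eq_csum (fun k kD => operator_term_expoly Xx kD FP)).
rewrite csumZ; last exact: (@abs_summable_peval _ _ _ nz _ _
  (fun k _ => size_term_poly u P k) (fun m => summable_term_poly u P m X0) x [::]).
congr (_ * _); symmetry; exact: (@peval_psum _ _ _ nz _ _
  (fun k _ => size_term_poly u P k) (fun m => summable_term_poly u P m X0) x [::]).
Qed.

(** * Quantitative bounds and the induction on [r] *)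

Lemma theta_ge0 v : X !=set0 -> 0 <= v -> (0 <= theta X a v)%E.
Proof.
move=> X0 v0; apply: nneseries_ge0 => k _ _; apply: mule_ge0.
  by rewrite lee_fin mulr_ge0// exprn_ge0// addr_ge0.
exact: coef_bound_ge0.
Qed.

(** One application of the operator. The factor [j + 1] collects the value of the affine coefficient
    and at most [j] derivatives falling on it. *)
Lemma normc_next_poly u P x (K : R) (j : nat) : X x ->
  (forall t, normc (peval x (pderiv t P)) <= K) ->
  (theta X a `|u| < +oo)%E ->
  forall t, (size t <= j)%N ->
    normc (peval x (pderiv t (next_poly u P))) <=
    j.+1%:R * (1 + `|x|) * K * (2 ^+ n * fine (theta X a `|u|)).
Proof.
move=> Xx PK thy t tj; have X0 : X !=set0 by exists x.
have K0 : 0 <= K by apply: le_trans (normc_ge0 _) (PK [::]).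
have x0 : 0 < 1 + `|x| by rewrite ltr_pwDl.
have u0 : 0 < 1 + `|u| by rewrite ltr_pwDl.
have D0 k : (0 <= coef_bound X a k)%E by exact: coef_bound_ge0.
(* An infinite bound in degree [k] would make the partial sum ending at [k], and hence [theta],
   infinite. *)
have Dfin k : (0 < k)%N -> (coef_bound X a k \is a fin_num)%E.
  move=> k0; rewrite ge0_fin_numE//; apply: contraTT thy; rewrite -!leNgt !leye_eq.
  move=> /eqP Dk; rewrite -leye_eq.
  apply: le_trans (nneseries_lim_ge (k.+1) _); last first.
    by move=> i _ _; rewrite mule_ge0// lee_fin mulr_ge0// exprn_ge0// ltW.
  rewrite big_nat_recr//= Dk gt0_muley; last by rewrite lte_fin mulr_gt0// exprn_gt0.
  rewrite addey// -ltNye; apply: lt_le_trans (_ : 0 <= _)%E => //.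
  apply: sume_ge0 => i _.
  by rewrite mule_ge0// lee_fin mulr_ge0// exprn_ge0// ltW.
rewrite (@peval_psum _ _ _ nz _ _
  (fun k _ => size_term_poly u P k) (fun m => summable_term_poly u P m X0) x t).
have sum_t := @abs_summable_peval _ _ _ nz _ _
  (fun k _ => size_term_poly u P k) (fun m => summable_term_poly u P m X0) x t.
rewrite -lee_fin; apply: le_trans (normc_csum sum_t) _.
(* The term of [theta] without [2 ^+ k], which the counting supplies. *)
pose g k := (((1 + `|u|) ^+ k)%:E * coef_bound X a k)%E.
apply: (@le_trans _ _ (\esum_(alpha in nz)
    (j.+1%:R * (1 + `|x|) * K * fine (g (mdegree alpha)))%:E)%E).
  apply: le_esum => alpha al0; rewrite lee_fin /g fineM ?Dfin//=.
  have -> : j.+1%:R * (1 + `|x|) * K *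
      ((1 + `|u|) ^+ mdegree alpha * fine (coef_bound X a (mdegree alpha))) =
      (j.+1%:R * (fine (coef_bound X a (mdegree alpha)) * (1 + `|x|))) *
      ((1 + `|u|) ^+ mdegree alpha * K) by ring.
  have := normc_pderiv_affine (c alpha) (fun i => coord_le_norm (d alpha) i)
    (fun t => normc_pderiv_twists (index_seq alpha) (fun i => coord_le_norm u i) PK t) t.
  rewrite size_index_seq => /le_trans; apply; apply: ler_wpM2r.
    by rewrite mulr_ge0// exprn_ge0// ltW.
  (* The derivative of order 0 in [coef_bound] controls the value of the coefficient, those of order
     1 its gradient [d alpha]. *)
  set D := fine _; have Da : `|c alpha + dotv x (d alpha)| <= D * (1 + `|x|).
    rewrite -ha// -ler_pdivrMr// -lee_fin fineK ?Dfin//.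
    apply: le_trans (@coef_bound_ge alpha [ffun=> 0%N] x Xx _); last first.
      by rewrite /mdegree big1// => i _; rewrite ffunE.
    rewrite /mpartial (_ : flatten _ = [::])//; apply/nilP.
    by rewrite /nilp -/(index_seq _) size_index_seq /mdegree big1// => i _; rewrite ffunE.
  have Dd : `|d alpha| <= D * (1 + `|x|).
    apply: norm_le_coord => [|i]; first by rewrite mulr_ge0 ?fine_ge0// ltW.
    rewrite -ler_pdivrMr// -lee_fin fineK ?Dfin//.
    apply: le_trans (@coef_bound_ge alpha (unit_index i) x Xx _); last first.
      by rewrite mdegree_unit.
    by rewrite /mpartial -/(index_seq _) index_seq_unit /= partial_coef.
  rewrite -natr1 addrC mulrDl mul1r; apply: lerD => //.
  by apply: ler_pM => //; rewrite ler_nat.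
rewrite esumZl; last by rewrite !mulr_ge0// ltW.
rewrite [leRHS]EFinM; apply: lee_wpmul2l; first by rewrite lee_fin !mulr_ge0// ltW.
rewrite EFinM fineK; last by rewrite ge0_fin_numE// theta_ge0.
under eq_esum => alpha al0.
  rewrite fineK; last by rewrite fin_numM// Dfin.
  over.
apply: le_trans (esum_mdegree hn0 _) _.
  by move=> k; rewrite mule_ge0// lee_fin exprn_ge0// ltW.
rewrite le_eqVlt; apply/orP; left; apply/eqP; congr (_ * _)%E.
by apply: eq_eseriesr => k _; rewrite muleA EFinM.
Qed.

(** The degree bound belongs to the induction, since it limits the order of the derivatives to be
    estimated. Finiteness of [theta] conditions only the estimate: the polynomial form also yields
    the domain statement when [theta] is infinite. *)
Lemma iter_operator_expoly u r : exists P : mpoly n R[i],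
  [/\ (mmeasure mdeg P <= r.+1)%N,
      forall x, X x -> iter r (operator a) (character u) x = expoly u P x &
      (theta X a `|u| < +oo)%E -> forall x t, X x ->
        normc (peval x (pderiv t P)) <=
        (r.+1)`!%:R * 2 ^+ (n * r) * (1 + `|x|) ^+ r * fine (theta X a `|u|) ^+ r].
Proof.
elim: r => [|r [P [Pr PX PK]]].
  exists 1; split=> [|x _|_ x t _]; first by rewrite mmeasure1.
    by rewrite /expoly /peval meval1 mulr1.
  rewrite muln0 !expr0 !mulr1; case: t => [|i t].
    by rewrite /peval meval1 ComplexField.Normc.normc1.
  by rewrite pderiv_eq0 ?mmeasure1// /peval meval0 ComplexField.Normc.normc0.
exists (next_poly u P); have Nr : (mmeasure mdeg (next_poly u P) <= r.+2)%N.
  by apply: leq_trans (msize_psum _ _ _) _; rewrite ltnS.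
split=> // [x Xx|thy x t Xx]; first exact: operator_expoly.
have th0 : 0 <= fine (theta X a `|u|) by rewrite fine_ge0// theta_ge0//; exists x.
(* The new polynomial has degree at most [r + 1], so longer sequences [t] annihilate it. The others
   give the factor [r + 2], which turns [(r + 1)!] into [(r + 2)!]. *)
have [tr|rt] := leqP (size t) r.+1; last first.
  rewrite pderiv_eq0; last exact: leq_trans rt.
  rewrite /peval meval0 ComplexField.Normc.normc0.
  by rewrite !mulr_ge0// ?exprn_ge0// addr_ge0.
apply: le_trans (normc_next_poly Xx (fun t => PK thy x t Xx) thy tr) _.
rewrite le_eqVlt; apply/orP; left; apply/eqP.
by rewrite [in RHS]factS natrM mulnS exprD !(exprS _ r); ring.
Qed.

End coefficients.

(** * Conclusion *)

Lemma normc_character (R : realType) (n : nat) (u x : 'rV[R]_n) :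
  ComplexField.Normc.normc (character u x) = 1.
Proof. by rewrite /= cos2Dsin2 sqrtr1. Qed.

Lemma expey (R : realType) (r : nat) : ((+oo : \bar R) ^+ r.+1 = +oo)%E.
Proof. by elim: r => // r IH; rewrite expeS IH gt0_muley. Qed.

(** The estimate is stated in the extended reals because [theta] may be infinite. The domain clause,
    for every [r], ensures that each further application of the operator is an absolutely convergent
    sum of genuine derivatives. *)
Theorem theorem4p1 (R : realType) (n : nat) (hn : (0 < n)%N)
  (X : set 'rV[R]_n) (hX : open X)
  (a : multi_index n -> 'rV[R]_n -> R)
  (c : multi_index n -> R) (d : multi_index n -> 'rV[R]_n)
  (ha : forall alpha, (0 < mdegree alpha)%N ->
     forall x, X x -> a alpha x = c alpha + dotv x (d alpha))
  (hconv : forall u x, X x ->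
     abs_summable (@nonzero_index n) (symbol_term a u x)) :
  forall (u : 'rV[R]_n) (r : nat),
    operator_domain X a (iter r (operator a) (character u)) /\
    forall x, X x ->
      ((ComplexField.Normc.normc (iter r (operator a) (character u) x))%:E <=
       ((r.+1)`!%:R * 2 ^+ (n * r) * (1 + `|x|) ^+ r)%:E
         * theta X a `|u| ^+ r)%E.
Proof.
move=> u r; have [P [_ PX PK]] := iter_operator_expoly hn hX ha hconv u r.
have [sRe sIm] := smooth_expoly X u P; split.
  split.
  - by apply: eq_smooth_on sRe => // x Xx; rewrite PX.
  - by apply: eq_smooth_on sIm => // x Xx; rewrite PX.
  - by move=> x Xx; apply: (abs_summable_operator hX ha hconv Xx PX).
move=> x Xx; have th0 : (0 <= theta X a `|u|)%E by apply: theta_ge0 => //; exists x.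
have [thy|] := ltP (theta X a `|u|) +oo%E.
  have thf : theta X a `|u| \is a fin_num by rewrite ge0_fin_numE.
  rewrite -[theta _ _ _]fineK// -EFin_expe -EFinM lee_fin PX//.
  by rewrite ComplexField.Normc.normcM normc_character mul1r; exact: (PK thy x [::]).
(* For infinite [theta] the power is 1 when [r = 0], and both sides equal 1; otherwise the
   right-hand side is +oo, its real factor being positive. *)
rewrite leye_eq => /eqP ->; case: r {P PX PK sRe sIm} => [|r].
  by rewrite /iter normc_character expe0 mule1 muln0 !expr0 !mulr1.
rewrite expey gt0_muley ?leey// lte_fin !mulr_gt0// ?exprn_gt0//.
Qed.
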